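(* Let $(a_n)_{n\ge 1}$ be a sequence with $a_n\ge 0$ for all $n$, and let $\beta\le 0<\alpha$ and $0<p<1$ be real numbers. If $0<p\le (1-\beta)/(2+\alpha)$, then $$\sum_{n=1}^{\infty}\frac{1}{n^{\beta}}\Big(\frac{1}{n^{\alpha}}\sum_{k=n}^{\infty}\big((k+1)^{\alpha}-k^{\alpha}\big)a_k\Big)^p\ \ge\ \Big(\frac{\alpha p}{1-\beta-\alpha p}\Big)^p\sum_{n=1}^{\infty}\frac{a_n^p}{n^{\beta}} .$$ The constant $\big(\alpha p/(1-\beta-\alpha p)\big)^p$ is best possible.
   Context: All sums have nonnegative terms and take values in $[0,+\infty]$, with $(+\infty)^p=+\infty$ for $p>0$. ''Best possible'' means that, for the given $\alpha,\beta,p$, the constant cannot be replaced by a larger one so that the inequality still holds for all nonnegative sequences $(a_n)$. *)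

(* Defs.v *)
From HB Require Import structures.
From mathcomp Require Import all_boot all_order all_algebra.
From mathcomp Require Import all_classical all_reals all_analysis.

Set Implicit Arguments.
Unset Strict Implicit.
Unset Printing Implicit Defensive.

Import Order.TTheory GRing.Theory Num.Theory.
Import numFieldNormedType.Exports.

Local Open Scope ring_scope.

(* A sequence (a_n)_{n >= 1} is encoded as a function on nat whose value at 0
   is never used. The inner tail sum may be +oo, so the outer p-th power is
   that of the extended reals, poweR. *)
Definition tail_mean_sum (R : realType) (alpha beta p : R) (a : nat -> R)
    : \bar R :=
  (\sum_(1 <= n <oo)
     ((n%:R `^ beta)^-1)%:E *
     (((n%:R `^ alpha)^-1)%:E *
      \sum_(n <= k <oo)
        (((k.+1)%:R `^ alpha - k%:R `^ alpha) * a k)%:E) `^ p)%E.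

Definition weighted_power_sum (R : realType) (beta p : R) (a : nat -> R)
    : \bar R :=
  (\sum_(1 <= n <oo) ((a n `^ p) / (n%:R `^ beta))%:E)%E.

Definition reverse_hardy (R : realType) (alpha beta p C : R) : Prop :=
  forall a : nat -> R, (forall n : nat, (1 <= n)%N -> 0 <= a n) ->
    (C%:E * weighted_power_sum beta p a <= tail_mean_sum alpha beta p a)%E.

(* Main.v *)
Require Import Defs.
From HB Require Import structures.
From mathcomp Require Import all_boot all_order all_algebra.
From mathcomp Require Import all_classical all_reals all_analysis.
From mathcomp Require Import ring lra.

Import Order.TTheory GRing.Theory Num.Theory.
Import numFieldNormedType.Exports.

Local Open Scope ring_scope.

(* Put s = (1 - beta) / p - alpha, so that the constant is (alpha / s)^p and the
   hypothesis on p says s >= 2. Let b_n = (n+1)^alpha - n^alpha, let S_n be the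
   tail sum of b_k a_k, q_n = n^(-s) and P_n = \sum_(k <= n) k^(s-1). The
   Levin-Stechkin lower bound for P_n and Hoelder's inequality for integrals
   over [n, n+1] give
     (alpha / s)^p n^(-beta) <= P_n (q_n - q_(n+1))^(1-p) b_n^p,
   and Hoelder's inequality for two terms turns this into
     (alpha / s)^p n^(-beta) a_n^p
       <= P_n (q_n^(1-p) S_n^p - q_(n+1)^(1-p) S_(n+1)^p).
   Summation by parts concludes, because
   (P_n - P_(n-1)) q_n^(1-p) = n^(-beta - alpha p).
   For sharpness take S_n = n^(-s) - N^(-s) for n <= N: the left-hand side is at
   most the harmonic sum up to N, while (alpha / s)^p times the right-hand side
   differs from it by a bounded amount. *)

(** * Elementary inequalities for real powers *)

Section RealLemmas.
Variable R : realType.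
Implicit Types (p r m x y : R).

Lemma is_derive_ge0_le (f df : R -> R) (a b : R) : a <= b ->
  (forall x, a <= x <= b -> is_derive x 1 f (df x)) ->
  (forall x, a <= x <= b -> 0 <= df x) -> f a <= f b.
Proof.
move=> leab fdf df0.
have [x|x|c] := @MVT_segment R f df a b leab.
- rewrite in_itv/= => /andP[ax xb]; apply: fdf; lra.
- apply: derivable_within_continuous => y; rewrite in_itv/= => /fdf h.
  exact: (@ex_derive _ _ _ _ _ _ _ h).
rewrite in_itv/= => /df0 c0 e.
by rewrite -subr_ge0 e mulr_ge0// subr_ge0.
Qed.

Lemma is_derive_powR_affine (a b r x : R) : 0 < a + b * x ->
  is_derive x 1 (fun z : R => (a + b * z) `^ r)
    (b * (r * (a + b * x) `^ (r - 1))).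
Proof.
move=> h.
have := @is_derive1_comp R (@powR R ^~ r) (fun z : R => a + b * z) x _ _
  (@is_derive1_powR R r (a + b * x) h) _.
move/(_ b); rewrite mulrC; apply.
have -> : (fun z : R => a + b * z) = cst a + (b \*: (@id R)) by apply/funext.
by apply: is_derive_eq; rewrite /= add0r; apply: mulr1.
Qed.

(** Write y^(-k) = exp(-k ln y) and combine exp t >= 1 + t with ln y <= y - 1. *)
Lemma powR_bernoulli (k y : R) : 0 <= k -> 0 < y ->
  1 - k * (y - 1) <= y `^ (- k).
Proof.
move=> k0 y0; rewrite /powR gt_eqF//.
apply: le_trans (expR_ge1Dx _); rewrite mulNr lerD2l lerN2 ler_wpM2l//.
have := @le_ln1Dx R (y - 1); rewrite subrKC; apply; lra.
Qed.

(** Both sides vanish at 0. Their difference has derivative m ((1-z)^(-m-1) + (1+z)^(-m-1) - 2), and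
    the Bernoulli bounds for the two powers add up to 2. *)
Lemma powR_opp_sub_ge (m x : R) : 0 <= m -> 0 <= x -> x < 1 ->
  2 * m * x <= (1 - x) `^ (- m) - (1 + x) `^ (- m).
Proof.
move=> m0 x0 x1.
pose f z : R := (1 + -1 * z) `^ (- m) - (1 + 1 * z) `^ (- m) - 2 * m * z.
have: f 0 <= f x.
  apply: (@is_derive_ge0_le f (fun z => (-1 * (- m * (1 + -1 * z) `^ (- m - 1)))
   - (1 * (- m * (1 + 1 * z) `^ (- m - 1))) - 2 * m)) => // z /andP[z0 zx].
    have h1 : is_derive z 1 _ _ := @is_derive_powR_affine 1 (-1) (- m) z _.
    have h2 : is_derive z 1 _ _ := @is_derive_powR_affine 1 1 (- m) z _.
    have h3 : is_derive z 1 (fun z : R => 2 * m * z) (2 * m).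
      have -> : (fun z : R => 2 * m * z) = ((2 * m) \*: (@id R)) by apply/funext.
      by apply: is_derive_eq; apply: mulr1.
    apply: is_deriveB; apply: is_deriveB; first (apply: h1; lra); apply: h2; lra.
  have -> : - m - 1 = - (m + 1) by ring.
  have := @powR_bernoulli (m + 1) (1 + -1 * z) _ _.
  have := @powR_bernoulli (m + 1) (1 + 1 * z) _ _.
  nra.
rewrite /f !mulr0 !addr0 powR1 !mul1r mulN1r; lra.
Qed.

(** This is what the induction step of [levin_stechkin] reduces to. The expression vanishes at 0.
    With A = (1+z)^(r-1) and B = (1-z)^(r-1), its derivative is r (A - B - 2 (r-1) z A B), which is
    nonnegative by [powR_opp_sub_ge] for m = r - 1, multiplied by A B. *)
Lemma powR_quadratic_ge0 (r x : R) : 1 <= r -> 0 <= x -> x < 1 ->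
  0 <= (1 + x) `^ r + (1 - x) `^ r + (r - 1) * ((1 + x) `^ r * (1 - x) `^ r)
       - (r + 1).
Proof.
move=> r1 x0 x1.
pose u z : R := (1 + 1 * z) `^ r; pose v z : R := (1 + -1 * z) `^ r.
pose du z : R := 1 * (r * (1 + 1 * z) `^ (r - 1)).
pose dv z : R := -1 * (r * (1 + -1 * z) `^ (r - 1)).
pose f : R -> R := u + v + ((r - 1) \*: (u * v)).
have: f 0 <= f x.
  apply: (@is_derive_ge0_le f (fun z => du z + dv z +
     (r - 1) *: (u z *: dv z + v z *: du z))) => // z /andP[z0 zx].
    have h1 : is_derive z 1 u (du z) by apply: is_derive_powR_affine; lra.
    have h2 : is_derive z 1 v (dv z) by apply: is_derive_powR_affine; lra.
    apply: is_deriveD.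
  rewrite /du /dv /u /v /= /GRing.scale /=.
  have Er y : 0 < y -> y `^ r = y * y `^ (r - 1).
    by move=> y0; rewrite mulr_powRB1 ?ltW//; lra.
  have a0 : 0 < 1 + 1 * z by lra.
  have b0 : 0 < 1 + -1 * z by lra.
  rewrite (Er _ a0) (Er _ b0).
  have := @powR_opp_sub_ge (r - 1) z.
  have -> : 1 - z = 1 + -1 * z by lra.
  have -> : 1 + z = 1 + 1 * z by lra.
  rewrite !powRN => /(_ _ z0) h.
  have {}h := h ltac:(lra) ltac:(lra).
  have A0 := powR_gt0 (r - 1) a0; have B0 := powR_gt0 (r - 1) b0.
  move: A0 B0 h; set A := _ `^ _; set B := (1 + -1 * z) `^ _ => A0 B0 h.
  have h' : 2 * (r - 1) * z * (A * B) <= A - B.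
    have -> : A - B = (B^-1 - A^-1) * (A * B) by field; rewrite !gt_eqF.
    by rewrite ler_pM2r// mulr_gt0.
  have -> : 1 * (r * A) + -1 * (r * B) +
      (r - 1) * ((1 + 1 * z) * A * (-1 * (r * B)) +
                 (1 + -1 * z) * B * (1 * (r * A))) =
      r * (A - B - 2 * (r - 1) * z * (A * B)) by ring.
  apply: mulr_ge0; lra.
have fE z : f z = u z + v z + (r - 1) * (u z * v z) by [].
rewrite !fE /u /v !mulr0 !addr0 powR1 !mul1r mulN1r mulr1; lra.
Qed.

Lemma powR_weighted_AMGM p x y : 0 < p -> p < 1 -> 0 <= x -> 0 <= y ->
  x `^ p * y `^ (1 - p) <= p * x + (1 - p) * y.
Proof.
move=> p0 p1 x0 y0.
have q0 : 0 < 1 - p by lra.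
have := @conjugate_powR R (x `^ p) (y `^ (1 - p)) p^-1 (1 - p)^-1.
rewrite -!powRrM !mulfV ?gt_eqF// !invrK !powRr1//.
rewrite ![_ * p]mulrC ![_ * (1 - p)]mulrC; apply; rewrite ?powR_ge0 ?invr_gt0//.
lra.
Qed.

Lemma powR_hoelder2 p (x1 x2 y1 y2 : R) : 0 < p -> p < 1 ->
  0 <= x1 -> 0 <= x2 -> 0 <= y1 -> 0 <= y2 ->
  x1 `^ (1 - p) * y1 `^ p + x2 `^ (1 - p) * y2 `^ p <=
  (x1 + x2) `^ (1 - p) * (y1 + y2) `^ p.
Proof.
move=> p0 p1 x10 x20 y10 y20.
have q0 : 0 < 1 - p by lra.
have := @hoelder2 R (x1 `^ (1 - p)) (x2 `^ (1 - p)) (y1 `^ p) (y2 `^ p)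
  (1 - p)^-1 p^-1.
rewrite -!powRrM !mulfV ?gt_eqF// !invrK !powRr1//; apply;
  rewrite ?powR_ge0 ?invr_gt0//; lra.
Qed.

End RealLemmas.

(** * Power-sum estimates and the inequality for truncated sums *)

Section PowerInequalities.
Variable R : realType.
Implicit Types (p s r alpha beta : R) (n : nat).

Lemma powR_nat_increment_gt0 alpha n : 0 < alpha ->
  0 < n.+1%:R `^ alpha - n%:R `^ alpha :> R.
Proof.
move=> a0; rewrite subr_gt0; apply: (gt0_ltr_powR a0);
by rewrite ?nnegrE ?ler0n ?ltr_nat.
Qed.

Lemma powR_opp_nat_decrement_ge0 s n : 0 < s -> (1 <= n)%N ->
  0 <= n%:R `^ (- s) - n.+1%:R `^ (- s) :> R.
Proof.
move=> s0 n1; rewrite subr_ge0 !powRN lef_pV2 ?posrE ?powR_gt0 ?ltr0n//.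
by rewrite ge0_ler_powR ?nnegrE ?ler0n ?ler_nat ?(ltW s0).
Qed.

Lemma powR_div r (x y : R) : 0 <= x -> 0 <= y -> (x / y) `^ r = x `^ r / y `^ r.
Proof.
move=> x0 y0.
by rewrite powRM ?invr_ge0// -(powR_inv1 y0) -powRrM mulN1r powRN.
Qed.

(** Induction on n; factoring out the power of n+2 turns the step into an inequality between (1+x)^r
    and (1-x)^r with x = 1/(n+2). *)
Lemma levin_stechkin r n : 1 <= r ->
  r / (r + 1) <= (\sum_(1 <= k < n.+2) k%:R `^ r) *
                 (n.+1%:R `^ (- r) - n.+2%:R `^ (- r)).
Proof.
move=> r1; elim: n => [|n IH].
  rewrite big_nat1 !powR1 mul1r.
  (* The case n = 0 amounts to r + 1 <= 2^r, which is Bernoulli's inequality at 1/2 with exponent r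
     - 1. *)
  have := @powR_bernoulli R (r - 1) 2^-1 ltac:(lra) ltac:(lra).
  have -> : 2^-1 `^ (- (r - 1)) = 2 `^ r / 2 :> R.
    rewrite -{1}[2^-1 : R]powR_inv1// -powRrM mulN1r opprK powRB; last exact/implyP.
    by rewrite powRr1.
  rewrite powRN.
  have : 0 < (2 : R) `^ r by rewrite powR_gt0.
  set y := 2 `^ r => y0 h.
  rewrite ler_pdivrMr; last lra.
  have h2 : r + 1 <= y by lra.
  have : y^-1 * (r + 1) <= 1 by rewrite mulrC ler_pdivrMr// mul1r.
  lra.
rewrite big_nat_recr//=.
move: IH; set P := \sum_(1 <= k < n.+2) _.
set x : R := n.+2%:R^-1.
have N0 : 0 < n.+2%:R :> R by rewrite ltr0n.
have x0 : 0 < x by rewrite invr_gt0.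
have x1 : x < 1 by rewrite invf_lt1// ltr1n.
have -> : n.+1%:R = n.+2%:R * (1 - x) :> R.
  by rewrite mulrBr divff ?gt_eqF// mulr1 -[n.+2%:R]natr1 addrK.
have -> : n.+3%:R = n.+2%:R * (1 + x) :> R.
  by rewrite mulrDr divff ?gt_eqF// mulr1 natr1.
rewrite !powRM; try lra.
rewrite !powRN.
have U1 : 1 < (1 + x) `^ r.
  have /(_ 1 (1 + x)) := @gt0_ltr_powR R r ltac:(lra).
  by rewrite powR1 !nnegrE; apply; lra.
have V1 : (1 - x) `^ r < 1.
  have /(_ (1 - x) 1) := @gt0_ltr_powR R r ltac:(lra).
  by rewrite powR1 !nnegrE; apply; lra.
have V0 : 0 < (1 - x) `^ r by apply: powR_gt0; lra.
have Q0 : 0 < n.+2%:R `^ r by apply: powR_gt0; lra.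
have := @powR_quadratic_ge0 R r x r1 (ltW x0) x1.
move: U1 V1 V0 Q0; set U := (1 + x) `^ r; set V := (1 - x) `^ r.
set Q := n.+2%:R `^ r => U1 V1 V0 Q0 quad IH.
have {}IH : r * V <= P / Q * (1 - V) * (r + 1).
  move: IH; rewrite ler_pdivrMr; last lra.
  have -> : P * (Q^-1 * V^-1 - Q^-1) * (r + 1) = (P / Q * (1 - V) * (r + 1)) / V.
    by field; rewrite !gt_eqF.
  by rewrite ler_pdivlMr.
rewrite ler_pdivrMr; last lra.
have -> : (P + Q) * (Q^-1 - Q^-1 * U^-1) * (r + 1)
    = (P / Q + 1) * (U - 1) * (r + 1) / U.
  by field; rewrite !gt_eqF; lra.
rewrite ler_pdivlMr; last lra.
(* After multiplication by 1 - V > 0, the induction hypothesis eliminates P/Q, and what remains is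
   exactly U + V + (r-1) U V >= r + 1. *)
rewrite -(@ler_pM2r _ (1 - V)); last lra.
apply: (@le_trans _ _ ((r * V + (1 - V) * (r + 1)) * (U - 1))); first lra.
have -> : (P / Q + 1) * (U - 1) * (r + 1) * (1 - V) =
  (P / Q * (1 - V) * (r + 1) + (1 - V) * (r + 1)) * (U - 1) by ring.
by rewrite ler_pM2r; lra.
Qed.

(* Hoelder's inequality for the integrals over [x, y] of t^(alpha-1) and
   t^(-s-1), whose weighted geometric mean is t^(-beta-s) >= x^(-beta) t^(-s).
   It is obtained by integrating the pointwise AM-GM inequality with weights
   normalised by the values B and M of the two integrals. *)
Lemma powR_increment_hoelder p s alpha beta (x y : R) :
  beta <= 0 -> 0 < alpha -> 0 < p -> p < 1 -> 1 < s ->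
  p * (s + alpha) = 1 - beta -> 0 < x -> x < y ->
  x `^ (- beta) * ((x `^ (1 - s) - y `^ (1 - s)) / (s - 1)) <=
  ((y `^ alpha - x `^ alpha) / alpha) `^ p *
  ((x `^ (- s) - y `^ (- s)) / s) `^ (1 - p).
Proof.
move=> b0 a0 p0 p1 s1 psa x0 xy.
have y0 : 0 < y by lra.
set B := (_ / alpha); set M := (_ / s).
have B0 : 0 < B.
  rewrite divr_gt0// subr_gt0.
  by apply: (gt0_ltr_powR a0); rewrite ?nnegrE ?ltW.
have M0 : 0 < M.
  rewrite divr_gt0//; last lra.
  rewrite subr_gt0 !powRN ltf_pV2 ?posrE ?powR_gt0//.
  by apply: (gt0_ltr_powR (_ : 0 < s)); rewrite ?nnegrE ?ltW//; lra.
set H := B `^ p * M `^ (1 - p).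
have H0 : 0 < H by rewrite mulr_gt0 ?powR_gt0.
pose f0 (z : R) : R := z `^ alpha.
pose f1 (z : R) : R := z `^ (- s).
pose f2 (z : R) : R := z `^ (1 - s).
(* The coefficients make F an antiderivative of H (p t^(alpha-1) / B + (1-p) t^(-s-1) / M) -
   x^(-beta) t^(-s). *)
pose k0 := p * (H / B) / alpha.
pose k1 := - ((1 - p) * (H / M) / s).
pose k2 := x `^ (- beta) / (s - 1).
pose F : R -> R := (k0 \*: f0) + (k1 \*: f1) + (k2 \*: f2).
have FE z : F z = k0 * z `^ alpha + k1 * z `^ (- s) + k2 * z `^ (1 - s) by [].
have: F x <= F y.
  apply: (@is_derive_ge0_le R F (fun z => k0 *: (alpha * z `^ (alpha - 1)) +
    k1 *: (- s * z `^ (- s - 1)) + k2 *: ((1 - s) * z `^ (1 - s - 1)))).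
  - exact: ltW.
  - move=> z /andP[xz zy].
    have z0 : 0 < z by lra.
    have h0 : is_derive z 1 f0 _ := is_derive1_powR alpha z0.
    have h1 : is_derive z 1 f1 _ := is_derive1_powR (- s) z0.
    have h2 : is_derive z 1 f2 _ := is_derive1_powR (1 - s) z0.
    apply: is_deriveD.
  - move=> z /andP[xz zy].
    have z0 : 0 < z by lra.
    rewrite /GRing.scale /= /k0 /k1 /k2.
    have -> : p * (H / B) / alpha * (alpha * z `^ (alpha - 1)) +
        - ((1 - p) * (H / M) / s) * (- s * z `^ (- s - 1)) +
        x `^ (- beta) / (s - 1) * ((1 - s) * z `^ (1 - s - 1)) =
        H * (p * (z `^ (alpha - 1) / B) + (1 - p) * (z `^ (- s - 1) / M))
        - x `^ (- beta) * z `^ (1 - s - 1).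
      by field; rewrite ?gt_eqF//; lra.
    rewrite subr_ge0.
    apply: (@le_trans _ _ (z `^ (- beta) * z `^ (1 - s - 1))).
      rewrite ler_wpM2r ?powR_ge0//.
      by apply: ge0_ler_powR; rewrite ?nnegrE; lra.
    have := @powR_weighted_AMGM R p (z `^ (alpha - 1) / B) (z `^ (- s - 1) / M)
       p0 p1 (divr_ge0 (powR_ge0 _ _) (ltW B0))
       (divr_ge0 (powR_ge0 _ _) (ltW M0)).
    rewrite -(@ler_pM2l _ H)//; apply: le_trans.
    rewrite (powR_div p _ _ (powR_ge0 z _) (ltW B0)).
    rewrite (powR_div (1 - p) _ _ (powR_ge0 z _) (ltW M0)) -!powRrM.
    rewrite [leRHS](_ : _ = z `^ ((alpha - 1) * p) * z `^ ((- s - 1) * (1 - p))).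
      rewrite -!powRD ?(gt_eqF z0) ?implybT//.
      by rewrite le_eqVlt; apply/orP; left; apply/eqP; congr powR; lra.
    by rewrite /H; field; rewrite !gt_eqF ?powR_gt0.
rewrite !FE /k0 /k1 /k2 => h.
(* Since B and M are the two integrals, the first two terms of F increase by p H and (1-p) H, hence
   by H in total. *)
have e1 : p * (H / B) / alpha * y `^ alpha - p * (H / B) / alpha * x `^ alpha =
    p * H.
  have -> : y `^ alpha = alpha * B + x `^ alpha
    by rewrite /B mulrC divfK ?gt_eqF// subrK.
  by field; rewrite !gt_eqF.
have e2 : (1 - p) * (H / M) / s * x `^ (- s) -
    (1 - p) * (H / M) / s * y `^ (- s) = (1 - p) * H.
  have -> : x `^ (- s) = s * M + y `^ (- s).
    by rewrite /M mulrC divfK ?subrK// gt_eqF//; lra.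
  by field; rewrite !gt_eqF//; lra.
lra.
Qed.

(** The difference T of the powers with exponent 1 - s links two bounds: Levin-Stechkin for r = s -
    1 >= 1 gives P T >= (s-1)/s, and Hoelder on [n+1, n+2] bounds (n+1)^(-beta) T/(s-1) from
    above. *)
Lemma increment_product_ge p s alpha beta n :
  beta <= 0 -> 0 < alpha -> 0 < p -> p < 1 -> 2 <= s ->
  p * (s + alpha) = 1 - beta ->
  (alpha / s) `^ p * n.+1%:R `^ (- beta) <=
  (\sum_(1 <= k < n.+2) k%:R `^ (s - 1)) *
  ((n.+1%:R `^ (- s) - n.+2%:R `^ (- s)) `^ (1 - p) *
   (n.+2%:R `^ alpha - n.+1%:R `^ alpha) `^ p).
Proof.
move=> b0 a0 p0 p1 s2 psa.
have s0 : 0 < s by lra.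
have n0 : 0 < n.+1%:R :> R by rewrite ltr0n.
have nn : n.+1%:R < n.+2%:R :> R by rewrite ltr_nat.
have := @levin_stechkin (s - 1) n ltac:(lra).
rewrite subrK opprB => ls.
have := @powR_increment_hoelder p s alpha beta _ _ b0 a0 p0 p1 ltac:(lra) psa n0 nn.
move: ls; set P := \sum_(_ <= _ < _) _; set T := _ `^ (1 - s) - _ => ls.
have P0 : 0 <= P by apply: sumr_ge0 => i _; exact: powR_ge0.
have B0 : 0 <= n.+2%:R `^ alpha - n.+1%:R `^ alpha :> R.
  exact/ltW/powR_nat_increment_gt0.
have M0 : 0 <= n.+1%:R `^ (- s) - n.+2%:R `^ (- s) :> R.
  exact: powR_opp_nat_decrement_ge0.
rewrite (powR_div p _ _ B0 (ltW a0)) (powR_div (1 - p) _ _ M0 (ltW s0)).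
rewrite (powR_div p _ _ (ltW a0) (ltW s0)).
rewrite [s `^ (1 - p)]powRB ?(gt_eqF s0) ?implybT// (powRr1 (ltW s0)).
have al0 : 0 < alpha `^ p by exact: powR_gt0.
have sp0 : 0 < s `^ p by exact: powR_gt0.
set X := n.+1%:R `^ (- beta); set Bp := (_ - _) `^ p; set Mp := (_ - _) `^ (1 - p) => h.
have X0 : 0 <= X by exact: powR_ge0.
have h1 : X * s^-1 <= P * (X * (T / (s - 1))).
  rewrite mulrCA ler_wpM2l// mulrA ler_pdivlMr; last lra.
  by rewrite mulrC.
have {}h := ler_wpM2l P0 h.
have {h h1} := le_trans h1 h.
(* The factor alpha^p s^(1-p) clears the denominators of the two normalised integrals. *)
rewrite -(@ler_pM2l _ (alpha `^ p / s `^ p * s)); last by rewrite mulr_gt0 ?divr_gt0.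
have -> : alpha `^ p / s `^ p * s * (X / s) = alpha `^ p / s `^ p * X.
  by field; rewrite !gt_eqF.
move=> /le_trans; apply.
by rewrite le_eqVlt; apply/orP; left; apply/eqP; field; rewrite !gt_eqF.
Qed.

(** Truncating the inner sums as well keeps every quantity real, so that summation by parts is
    legitimate; N is sent to infinity only in the theorem. *)
Lemma truncated_reverse_hardy p s alpha beta (a : nat -> R) (N : nat) :
  beta <= 0 -> 0 < alpha -> 0 < p -> p < 1 -> 2 <= s ->
  p * (s + alpha) = 1 - beta ->
  (forall n : nat, (1 <= n)%N -> 0 <= a n) ->
  (alpha / s) `^ p * \sum_(1 <= n < N) (a n `^ p * n%:R `^ (- beta)) <=
  \sum_(1 <= n < N) n%:R `^ (- beta) * (n%:R `^ (- alpha) *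
     \sum_(n <= k < N) (k.+1%:R `^ alpha - k%:R `^ alpha) * a k) `^ p.
Proof.
move=> b0 a0 p0 p1 s2 psa age0.
have [N0|N0] := leqP N 0; first by rewrite !big_geq ?(leq_trans N0)// mulr0.
have B0 k : 0 <= k.+1%:R `^ alpha - k%:R `^ alpha :> R.
  exact/ltW/powR_nat_increment_gt0.
pose S n : R := \sum_(n <= k < N) (k.+1%:R `^ alpha - k%:R `^ alpha) * a k.
have S0 n : (1 <= n)%N -> 0 <= S n.
  move=> n1; rewrite /S big_nat_cond; apply: sumr_ge0 => k /andP[/andP[nk _] _].
  by rewrite mulr_ge0// age0// (leq_trans n1).
(* The sum stops at n - 1: the P_n of the overview is [P n.+1], and [P 1] is empty. *)
pose P n : R := \sum_(1 <= k < n) k%:R `^ (s - 1).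
pose g n : R := (n%:R `^ (- s)) `^ (1 - p) * S n `^ p.
pose f n := P n * g n.
apply: (@le_trans _ _ (\sum_(1 <= n < N) (P n.+1 * (g n - g n.+1)))).
  rewrite mulr_sumr big_nat_cond [leRHS]big_nat_cond; apply: ler_sum.
  move=> [//|n] /andP[/andP[_ nN] _].
  have an0 := age0 n.+1 isT.
  have SE : S n.+1 = (n.+2%:R `^ alpha - n.+1%:R `^ alpha) * a n.+1 + S n.+2.
    by rewrite /S big_ltn.
  have M0 : 0 <= n.+1%:R `^ (- s) - n.+2%:R `^ (- s) :> R.
    by apply: powR_opp_nat_decrement_ge0 => //; lra.
  (* The two terms come from splitting q as (q_(n+1) - q_(n+2)) + q_(n+2) and S as b_(n+1) a_(n+1) +
     S_(n+2). *)
  have := @powR_hoelder2 R p _ (n.+2%:R `^ (- s))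
    ((n.+2%:R `^ alpha - n.+1%:R `^ alpha) * a n.+1) (S n.+2) p0 p1 M0
    (powR_ge0 _ _) (mulr_ge0 (B0 n.+1) an0) (S0 n.+2 isT).
  rewrite -SE subrK (@powRM R _ _ p (B0 n.+1) an0) -lerBrDr => h.
  have P0 : 0 <= P n.+2 by apply: sumr_ge0 => i _; exact: powR_ge0.
  have {}h := ler_wpM2l P0 h; apply: le_trans h.
  have := @increment_product_ge p s alpha beta n b0 a0 p0 p1 s2 psa.
  move=> /(ler_wpM2l (powR_ge0 (a n.+1) p)).
  have mulE u v w z : u * (v * (w * z)) = v * (w * (z * u)) :> R by ring.
  by rewrite mulrCA mulE.
have -> : \sum_(1 <= n < N) (P n.+1 * (g n - g n.+1)) =
    - (f N - f 1%N) + \sum_(1 <= n < N) (n%:R `^ (s - 1) * g n).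
  rewrite -telescope_sumr// -sumrN -big_split/= big_nat_cond [RHS]big_nat_cond.
  apply: eq_bigr => n /andP[/andP[n1 _] _].
  by rewrite /f /P big_nat_recr//=; ring.
have -> : f 1%N = 0 by rewrite /f /P big_geq// mul0r.
apply: (@le_trans _ _ (\sum_(1 <= n < N) (n%:R `^ (s - 1) * g n))).
  rewrite gerDr subr0 oppr_le0 mulr_ge0//.
    by apply: sumr_ge0 => i _; exact: powR_ge0.
  by rewrite mulr_ge0 ?powR_ge0.
rewrite big_nat_cond [leRHS]big_nat_cond; apply: ler_sum => n /andP[/andP[n1 _] _].
have n0 : 0 < n%:R :> R by rewrite ltr0n.
rewrite -/(S n) (@powRM R _ _ p (powR_ge0 n%:R _) (S0 n n1)) /g !mulrA.
apply: ler_wpM2r; first exact: powR_ge0.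
rewrite -!powRrM -!powRD ?(gt_eqF n0) ?implybT//.
by rewrite le_eqVlt; apply/orP; left; apply/eqP; congr powR; lra.
Qed.

End PowerInequalities.

(** * Extremal sequences and the harmonic series *)

Section Sharpness.
Variable R : realType.
Implicit Types (p s alpha beta : R) (n N : nat).

(** On [x, y] one has t^(-s-1) >= y^(-s-alpha) t^(alpha-1); integrate. For x = n and y = n+1 this
    bounds the extremal a_n below by (s / alpha) (n+1)^(-s-alpha). *)
Lemma powR_increment_ratio_ge s alpha (x y : R) :
  0 < s -> 0 < alpha -> 0 < x -> x <= y ->
  s * y `^ (- s - alpha) * (y `^ alpha - x `^ alpha) <=
  alpha * (x `^ (- s) - y `^ (- s)).
Proof.
move=> s0 a0 x0 xy.
pose k := s * y `^ (- s - alpha).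
pose f0 (z : R) : R := z `^ (- s).
pose f1 (z : R) : R := z `^ alpha.
pose F : R -> R := ((- alpha) \*: f0) + ((- k) \*: f1).
have FE z : F z = - alpha * z `^ (- s) + - k * z `^ alpha by [].
have: F x <= F y.
  apply: (@is_derive_ge0_le R F (fun z => (- alpha) *: (- s * z `^ (- s - 1)) +
    (- k) *: (alpha * z `^ (alpha - 1)))) => //.
  - move=> z /andP[xz zy].
    have z0 : 0 < z by lra.
    have h0 : is_derive z 1 f0 _ := is_derive1_powR (- s) z0.
    have h1 : is_derive z 1 f1 _ := is_derive1_powR alpha z0.
    apply: is_deriveD.
  - move=> z /andP[xz zy].
    have z0 : 0 < z by lra.
    rewrite /GRing.scale /= /k.
    have -> : - s - 1 = (- s - alpha) + (alpha - 1) by ring.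
    rewrite (@powRD R z (- s - alpha) (alpha - 1)) ?(gt_eqF z0) ?implybT//.
    have -> : - alpha * (- s * (z `^ (- s - alpha) * z `^ (alpha - 1))) +
      - (s * y `^ (- s - alpha)) * (alpha * z `^ (alpha - 1)) =
      s * alpha * z `^ (alpha - 1) * (z `^ (- s - alpha) - y `^ (- s - alpha)).
      by ring.
    apply: mulr_ge0; first by rewrite !mulr_ge0 ?powR_ge0// ltW.
    have -> : - s - alpha = - (s + alpha) by ring.
    rewrite subr_ge0 !powRN lef_pV2 ?posrE ?powR_gt0//; last lra.
    by apply: ge0_ler_powR; rewrite ?nnegrE; lra.
rewrite !FE -/k; lra.
Qed.

Lemma harmonic_sum_unbounded (K : R) :
  ~ forall N, \sum_(1 <= n < N.+1) n%:R^-1 <= K.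
Proof.
move=> h; apply: (@dvg_harmonic R); apply: nondecreasing_is_cvgn.
  by apply: nondecreasing_series => n _ _; exact: harmonic_ge0.
exists K => _ [N _ <-].
by rewrite seriesEnat/=; have := h N; rewrite big_add1.
Qed.

Lemma eseries_finite_support (f : nat -> \bar R) m N : (m <= N)%N ->
  (forall k, (m <= k)%N -> (0 <= f k)%E) ->
  (forall k, (N <= k)%N -> f k = 0%E) ->
  (\sum_(m <= k <oo) f k = \sum_(m <= k < N) f k)%E.
Proof.
move=> mN f0 fN.
rewrite (@nneseries_split R f m (N - m))// subnKC//.
by rewrite eseries0 ?adde0// => i + _; exact: fN.
Qed.

(* The truncation of the power-type extremal sequence for which the tail sums
   telescope to n^(-s) - N^(-s). *)
Definition truncated_extremal s alpha N n : R :=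
  if (n < N)%N
  then (n%:R `^ (- s) - n.+1%:R `^ (- s)) / (n.+1%:R `^ alpha - n%:R `^ alpha)
  else 0.

Lemma truncated_extremal_ge0 s alpha N n : 0 < s -> 0 < alpha -> (1 <= n)%N ->
  0 <= truncated_extremal s alpha N n.
Proof.
move=> s0 a0 n1; rewrite /truncated_extremal; case: ifP => // _.
apply: divr_ge0; first exact: powR_opp_nat_decrement_ge0.
exact/ltW/powR_nat_increment_gt0.
Qed.

Lemma truncated_extremal_tail s alpha N n : 0 < s -> 0 < alpha ->
  (1 <= n)%N -> (n <= N)%N ->
  (\sum_(n <= k <oo)
     ((k.+1%:R `^ alpha - k%:R `^ alpha) * truncated_extremal s alpha N k)%:E
   = (n%:R `^ (- s) - N%:R `^ (- s))%:E)%E.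
Proof.
move=> s0 a0 n1 nN.
rewrite (@eseries_finite_support _ n N nN).
- rewrite sumEFin; congr (_%:E).
  rewrite (@telescope_sumr_eq _ _ _ (fun k => - k%:R `^ (- s)))//.
    by rewrite opprK addrC.
  move=> k /andP[nk kN]; rewrite /truncated_extremal kN mulrC divfK.
    by rewrite opprK addrC.
  by rewrite gt_eqF// powR_nat_increment_gt0.
- move=> k nk; rewrite lee_fin mulr_ge0//.
    exact/ltW/powR_nat_increment_gt0.
  by apply: truncated_extremal_ge0 => //; exact: leq_trans nk.
- by move=> k Nk; rewrite /truncated_extremal ltnNge Nk/= mulr0.
Qed.

(** Dropping N^(-s) from the tail n^(-s) - N^(-s) leaves the power of n with exponent -beta - p
    (alpha + s) = -1. *)
Lemma tail_mean_sum_truncated_extremal p s alpha beta N :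
  0 < alpha -> 0 < p -> 0 < s -> p * (s + alpha) = 1 - beta -> (1 <= N)%N ->
  (tail_mean_sum alpha beta p (truncated_extremal s alpha N) <=
   (\sum_(1 <= n < N) n%:R^-1)%:E)%E.
Proof.
move=> a0 p0 s0 psa N1; rewrite /tail_mean_sum.
rewrite (@eseries_finite_support _ 1 N N1).
- rewrite -sumEFin big_nat_cond [leRHS]big_nat_cond.
  apply: lee_sum => n /andP[/andP[n1 nN] _].
  rewrite (@truncated_extremal_tail s alpha N n s0 a0 n1 (ltnW nN)).
  rewrite -EFinM lee_fin.
  have n0 : 0 < n%:R :> R by rewrite ltr0n.
  have q0 : 0 <= n%:R `^ (- s) - N%:R `^ (- s) :> R.
    rewrite subr_ge0 !powRN lef_pV2 ?posrE ?powR_gt0 ?ltr0n//.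
    by rewrite ge0_ler_powR ?nnegrE ?ler0n ?ler_nat ?(ltW s0) ?(ltnW nN).
  rewrite -!powRN.
  apply: (@le_trans _ _ (n%:R `^ (- beta) * (n%:R `^ (- alpha) * n%:R `^ (- s)) `^ p)).
    apply: ler_wpM2l; first exact: powR_ge0.
    apply: ge0_ler_powR; rewrite ?nnegrE ?(ltW p0) ?mulr_ge0 ?powR_ge0//.
    by apply: ler_wpM2l; rewrite ?powR_ge0// gerBl powR_ge0.
  rewrite -(powR_inv1 (ltW n0)) -powRD ?(gt_eqF n0) ?implybT//.
  rewrite -powRrM -powRD ?(gt_eqF n0) ?implybT//.
  by rewrite le_eqVlt; apply/orP; left; apply/eqP; congr powR; lra.
- move=> n n1; apply: mule_ge0; last exact: poweR_ge0.
  by rewrite lee_fin invr_ge0 powR_ge0.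
(* From N on the tails vanish, and 0^p = 0 because p is nonzero. *)
- move=> n nN; rewrite eseries0 ?mule0 ?poweR0r ?mule0 ?gt_eqF//.
  move=> k nk _.
  by rewrite /truncated_extremal ltnNge (leq_trans nN nk)/= mulr0.
Qed.

(** By [powR_increment_ratio_ge] the right-hand side is at least (n+1)^(beta-1) n^(-beta), because p
    (s + alpha) = 1 - beta. Bernoulli gives ((n+1)/n)^beta >= 1 + beta/n, and division by n+1 yields
    the bound. Its correction is written as a difference so that it telescopes over n. *)
Lemma truncated_extremal_powR_ge p s alpha beta N n :
  0 < alpha -> 0 < p -> 0 < s -> beta <= 0 -> p * (s + alpha) = 1 - beta ->
  (1 <= n)%N -> (n < N)%N ->
  n%:R^-1 - (1 - beta) * (n%:R^-1 - n.+1%:R^-1) <=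
  (alpha / s) `^ p *
    (truncated_extremal s alpha N n `^ p / n%:R `^ beta).
Proof.
move=> a0 p0 s0 b0 psa n1 nN.
have n0 : 0 < n%:R :> R by rewrite ltr0n.
have n0' : 0 < n.+1%:R :> R by rewrite ltr0n.
have lenn : n%:R <= n.+1%:R :> R by rewrite ler_nat.
have B0 := @powR_nat_increment_gt0 R alpha n a0.
have te0 := @truncated_extremal_ge0 s alpha N n s0 a0 n1.
have ratio : n.+1%:R `^ (- s - alpha) <= alpha / s * truncated_extremal s alpha N n.
  rewrite /truncated_extremal nN mulf_div ler_pdivlMr ?mulr_gt0//.
  rewrite mulrA (mulrC _ s).
  exact: powR_increment_ratio_ge.
apply: (@le_trans _ _ (n.+1%:R `^ (beta - 1) * n%:R `^ (- beta))); last first.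
  rewrite mulrA -powRM ?(divr_ge0 (ltW a0) (ltW s0))// powRN.
  apply: ler_wpM2r; first by rewrite invr_ge0 powR_ge0.
  have -> : beta - 1 = (- s - alpha) * p by lra.
  rewrite powRrM; apply: ge0_ler_powR; rewrite ?nnegrE ?(ltW p0)// ?powR_ge0//.
  by rewrite mulr_ge0// divr_ge0 ?ltW.
have := @powR_bernoulli R (- beta) (n.+1%:R / n%:R) ltac:(lra) (divr_gt0 n0' n0).
rewrite (powR_div _ _ _ _ (ltW n0') (ltW n0)) opprK.
have -> : n.+1%:R / n%:R - 1 = n%:R^-1 :> R.
  by rewrite -natr1 mulrDl divff ?gt_eqF// mul1r addrC addKr.
move=> /(ler_wpM2r (_ : 0 <= n.+1%:R^-1)) h.
have {}h := h ltac:(by rewrite invr_ge0 ltW).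
rewrite powRB ?(gt_eqF n0') ?implybT// powRr1 ?(ltW n0')// powRN.
move: h; congr (_ <= _).
  have E : n.+1%:R^-1 / n%:R = n%:R^-1 - n.+1%:R^-1 :> R.
    by rewrite -natr1; field; rewrite natr1 !gt_eqF.
  by rewrite mulrBl mul1r -mulrA [n%:R^-1 * _]mulrC E; ring.
by rewrite mulrAC.
Qed.

End Sharpness.

(** * Passage from truncated sums to series, and optimality of the constant *)

Theorem corollary1p1 (R : realType) (alpha beta p : R)
    (hbeta : beta <= 0) (halpha : 0 < alpha) (hp0 : 0 < p) (hp1 : p < 1)
    (hp : p <= (1 - beta) / (2 + alpha)) :
  reverse_hardy alpha beta p
    ((alpha * p / (1 - beta - alpha * p)) `^ p) /\
  (forall C : R, (alpha * p / (1 - beta - alpha * p)) `^ p < C ->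
     ~ reverse_hardy alpha beta p C).
Proof.
pose s : R := (1 - beta) / p - alpha.
have psa : p * (s + alpha) = 1 - beta by rewrite /s subrK mulrC divfK ?gt_eqF.
have s2 : 2 <= s.
  by rewrite /s lerBrDr ler_pdivlMr// mulrC -ler_pdivlMr//; lra.
have s0 : 0 < s by lra.
have -> : alpha * p / (1 - beta - alpha * p) = alpha / s.
  have -> : 1 - beta - alpha * p = p * s by rewrite -psa; ring.
  by field; rewrite !gt_eqF.
have c0 : 0 < (alpha / s) `^ p by rewrite powR_gt0// divr_gt0.
split.
- move=> a age0; rewrite /weighted_power_sum -nneseriesZl; last first.
    by move=> i _; rewrite lee_fin divr_ge0 ?powR_ge0.
  have term0 (n : nat) : (1 <= n)%N -> (0 <= (((n%:R `^ alpha)^-1)%:E *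
      \sum_(n <= k <oo) ((k.+1%:R `^ alpha - k%:R `^ alpha) * a k)%:E))%E.
    move=> n1; apply: mule_ge0; first by rewrite lee_fin invr_ge0 powR_ge0.
    apply: nneseries_ge0 => k nk _; rewrite lee_fin mulr_ge0//.
      exact/ltW/powR_nat_increment_gt0.
    by apply: age0; exact: leq_trans nk.
  (* It suffices to bound each partial sum of the weighted series. The truncated inequality does so,
     after which the inner sums grow to full tails and the outer sum to the whole series. *)
  apply: lime_le.
    apply: is_cvg_nneseries => n _ _.
    by rewrite -EFinM lee_fin mulr_ge0 ?(ltW c0)// divr_ge0 ?powR_ge0.
  apply: nearW => N.
  apply: (@le_trans _ _ (\sum_(1 <= n < N) (((n%:R `^ beta)^-1)%:E *
     (((n%:R `^ alpha)^-1)%:E *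
      \sum_(n <= k <oo) ((k.+1%:R `^ alpha - k%:R `^ alpha) * a k)%:E) `^ p))%E);
    last first.
    apply: nneseries_lim_ge => n n1 _; apply: mule_ge0; last exact: poweR_ge0.
    by rewrite lee_fin invr_ge0 powR_ge0.
  have := @truncated_reverse_hardy R p s alpha beta a N hbeta halpha hp0 hp1 s2
    psa age0.
  rewrite -lee_fin mulr_sumr -!sumEFin => fin.
  apply: le_trans (le_trans fin _).
    rewrite le_eqVlt; apply/orP; left; apply/eqP; apply: eq_bigr => n _.
    by rewrite -EFinM powRN.
  rewrite big_nat_cond [leRHS]big_nat_cond.
  apply: lee_sum => n /andP[/andP[n1 nN] _].
  rewrite EFinM -(poweR_EFin (_ * _)) powRN; apply: lee_wpmul2l.
    by rewrite lee_fin invr_ge0 powR_ge0.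
  have S0 : 0 <= \sum_(n <= k < N) (k.+1%:R `^ alpha - k%:R `^ alpha) * a k.
    rewrite big_nat_cond; apply: sumr_ge0 => k /andP[/andP[nk _] _].
    rewrite mulr_ge0//; first exact/ltW/powR_nat_increment_gt0.
    by apply: age0; exact: leq_trans nk.
  apply: gt0_ler_poweR; rewrite ?(ltW hp0)// ?in_itv/= ?leey ?andbT.
  + by rewrite lee_fin mulr_ge0 ?powR_ge0.
  + exact: term0.
  rewrite EFinM powRN; apply: lee_wpmul2l.
    by rewrite lee_fin invr_ge0 powR_ge0.
  rewrite -sumEFin; apply: nneseries_lim_ge => k nk _.
  rewrite lee_fin mulr_ge0//; first exact/ltW/powR_nat_increment_gt0.
  by apply: age0; exact: leq_trans nk.
move=> C cC hC.
set c := (alpha / s) `^ p in c0 cC.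
pose K := C / c.
have K1 : 1 < K by rewrite /K ltr_pdivlMr// mul1r.
(* With H the harmonic sum and W the weighted sum, C W <= H and H - (1 - beta) <= c W give K (H - (1
   - beta)) <= H. Solving for H yields this bound, uniform in N. *)
apply: (@harmonic_sum_unbounded R (K * (1 - beta) / (K - 1))) => N.
pose a := truncated_extremal R s alpha N.+1.
have := hC a (fun n => @truncated_extremal_ge0 R s alpha N.+1 n s0 halpha).
move=> /le_trans /(_ (@tail_mean_sum_truncated_extremal R p s alpha beta N.+1
  halpha hp0 s0 psa isT)).
rewrite /weighted_power_sum (@eseries_finite_support _ _ 1 N.+1)//; last 2 first.
- by move=> k _; rewrite lee_fin divr_ge0 ?powR_ge0.
- move=> k Nk; rewrite /a /truncated_extremal ltnNge Nk/= powR0 ?gt_eqF//.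
  by rewrite mul0r.
rewrite sumEFin -EFinM lee_fin.
set H := \sum_(1 <= n < N.+1) n%:R^-1; set W := \sum_(1 <= n < N.+1) _ => CW.
have HW : H - (1 - beta) <= c * W.
  apply: (@le_trans _ _ (\sum_(1 <= n < N.+1)
      (n%:R^-1 - (1 - beta) * (n%:R^-1 - n.+1%:R^-1)))).
    (* The corrections add up to (1 - beta) (1 - 1/(N+1)) <= 1 - beta. *)
    rewrite big_split/= -/H lerD2l -[leRHS]opprK lerN2 -sumrN.
    rewrite (eq_bigr (fun n => (1 - beta) * (n%:R^-1 - n.+1%:R^-1))); last first.
      by move=> n _; rewrite opprK.
    rewrite -mulr_sumr (@telescope_sumr_eq _ _ _ (fun n : nat => - n%:R^-1))//; last first.
      by move=> n _; rewrite opprK addrC.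
    have b0 : 0 <= 1 - beta by lra.
    apply: (ler_piMr b0).
    by rewrite opprK invr1 gerDr oppr_le0 invr_ge0 ler0n.
  rewrite /W mulr_sumr big_nat_cond [leRHS]big_nat_cond.
  apply: ler_sum => n /andP[/andP[n1 nN] _].
  exact: truncated_extremal_powR_ge.
have {}HW : K * (H - (1 - beta)) <= H.
  apply: le_trans CW; rewrite /K -ler_pdivlMl ?divr_gt0//; last first.
    exact: lt_trans cC.
  have C0 : 0 < C by exact: lt_trans cC.
  by apply: le_trans HW _; rewrite invf_div mulrA divfK// gt_eqF.
rewrite ler_pdivlMr; lra.
Qed.
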